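(* Fix an integer $M\ge1$ and real numbers $P,\sigma^2,\beta_1,\beta_2,\alpha_{\rm A\text{-}RIS}>0$. For integers $N\ge1$ and real $\alpha_{\rm NCR}\geq 0$ put $$\mathrm{SNR}_{\rm P\text{-}RIS}(N)=\frac{P\beta_1\beta_2N^2M}{\sigma^2},\quad \mathrm{SNR}_{\rm A\text{-}RIS}(N)=\frac{\alpha_{\rm A\text{-}RIS}^2P\beta_1\beta_2N^2M}{\sigma^2(1+\alpha_{\rm A\text{-}RIS}^2\beta_2MN)},\quad \mathrm{SNR}_{\rm NCR}(\alpha_{\rm NCR})=\frac{\alpha_{\rm NCR}^2PM\beta_1\beta_2}{\sigma^2(1+\alpha_{\rm NCR}^2\beta_2M)}.$$ Then $\mathrm{SNR}_{\rm P\text{-}RIS}(N)$ and $\mathrm{SNR}_{\rm A\text{-}RIS}(N)$ grow without bound as $N\to\infty$, whereas for every $\alpha_{\rm NCR}\ge0$, $$\mathrm{SNR}_{\rm NCR}(\alpha_{\rm NCR})\le\frac{P\beta_1}{\sigma^2},$$ and the right-hand side is the limit of $\mathrm{SNR}_{\rm NCR}(\alpha_{\rm NCR})$ as $\alpha_{\rm NCR}\to\infty$.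
   Context: These are the maximal uplink signal-to-noise ratios (without a direct user–base-station link) of systems assisted respectively by a passive RIS with $N$ elements, an active RIS with $N$ elements and per-element gain $\alpha_{\rm A\text{-}RIS}$, and a network-controlled repeater (NCR) with gain $\alpha_{\rm NCR}$; $M$ is the number of base station antennas. *)

(* Defs.v *)
From HB Require Import structures.
From mathcomp Require Import all_boot all_order all_algebra.
From mathcomp Require Import all_classical all_reals all_analysis.

Set Implicit Arguments.
Unset Strict Implicit.
Unset Printing Implicit Defensive.

Import Order.TTheory GRing.Theory Num.Theory.
Import numFieldNormedType.Exports.

Local Open Scope classical_set_scope.
Local Open Scope ring_scope.

(* [sigma2] is the noise variance sigma^2 itself, [P] the transmit power,
   [beta1], [beta2] the channel gains of the two hops, and [M] the number of
   base station antennas. *)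

Definition SNR_PRIS (R : realType) (P sigma2 beta1 beta2 : R) (M N : nat) : R :=
  (P * beta1 * beta2 * N%:R ^+ 2 * M%:R) / sigma2.

(* [alpha] is the amplitude gain of each of the [N] elements. *)
Definition SNR_ARIS (R : realType) (P sigma2 beta1 beta2 alpha : R)
    (M N : nat) : R :=
  (alpha ^+ 2 * P * beta1 * beta2 * N%:R ^+ 2 * M%:R) /
  (sigma2 * (1 + alpha ^+ 2 * beta2 * M%:R * N%:R)).

Definition SNR_NCR (R : realType) (P sigma2 beta1 beta2 : R) (M : nat)
    (alpha : R) : R :=
  (alpha ^+ 2 * P * M%:R * beta1 * beta2) /
  (sigma2 * (1 + alpha ^+ 2 * beta2 * M%:R)).

(* Main.v *)
Require Import Defs.
From mathcomp Require Import all_boot all_order all_algebra.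
From mathcomp Require Import all_classical all_reals all_analysis.
From mathcomp Require Import ring lra.

Import Order.TTheory GRing.Theory Num.Theory.
Import numFieldNormedType.Exports.

Local Open Scope classical_set_scope.
Local Open Scope ring_scope.

(** Both RIS ratios dominate a positive multiple of [N]. The passive one is quadratic in [N]; in the
    active one the amplified noise makes the denominator affine in [N], which costs only one of the
    two factors [N] ([SNR_PRIS_ge_linear], [SNR_ARIS_ge_linear]). For the repeater, put L = P beta1
    / sigma2 and k = alpha^2 beta2 M. The ratio is L k / (1 + k), so it falls short of L by exactly
    L / (1 + k) ([SNR_NCR_gap]). This gap is nonnegative, which gives the bound, and it vanishes as
    alpha grows, which gives the limit. *)

Lemma cvgry_ge_linear (R : realType) (u : nat -> R) (c : R) :
  0 < c -> (forall n, c * n%:R <= u n) -> u n @[n --> \oo] --> +oo.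
Proof.
move=> c_gt0 le_u; apply/cvgryPge => A.
have := nbhs_infty_ger (A / c); apply: filterS => n.
by rewrite ler_pdivrMr // mulrC => /le_trans; apply.
Qed.

Lemma SNR_PRIS_ge_linear (R : realType) (P sigma2 beta1 beta2 : R)
    (M N : nat) :
  0 <= P -> 0 <= sigma2 -> 0 <= beta1 -> 0 <= beta2 ->
  P * beta1 * beta2 * M%:R / sigma2 * N%:R <=
  SNR_PRIS P sigma2 beta1 beta2 M N.
Proof.
move=> P_ge0 s_ge0 b1_ge0 b2_ge0; rewrite /SNR_PRIS.
have -> : P * beta1 * beta2 * N%:R ^+ 2 * M%:R / sigma2 =
  P * beta1 * beta2 * M%:R / sigma2 * N%:R ^+ 2 by ring.
apply: ler_wpM2l; first by rewrite divr_ge0 ?mulr_ge0.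
by rewrite -natrX ler_nat; case: N => // N; rewrite leq_pmulr.
Qed.

(** With k = alpha^2 beta2 M, the point is that 1 + k N <= (1 + k) N for N >= 1, so one factor of
    N^2 absorbs the growth of the denominator. At N = 0 both sides vanish. *)
Lemma SNR_ARIS_ge_linear (R : realType) (P sigma2 beta1 beta2 alpha : R)
    (M N : nat) :
  0 <= P -> 0 < sigma2 -> 0 <= beta1 -> 0 <= beta2 ->
  alpha ^+ 2 * P * beta1 * beta2 * M%:R /
    (sigma2 * (1 + alpha ^+ 2 * beta2 * M%:R)) * N%:R <=
  SNR_ARIS P sigma2 beta1 beta2 alpha M N.
Proof.
move=> P_ge0 s_gt0 b1_ge0 b2_ge0; rewrite /SNR_ARIS.
case: N => [|N]; first by rewrite expr0n /= !(mulr0, mul0r).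
set n := N.+1%:R; set k := alpha ^+ 2 * beta2 * M%:R.
have n_ge1 : 1 <= n :> R by rewrite ler1n.
have k_ge0 : 0 <= k by rewrite mulr_ge0 // mulr_ge0 ?sqr_ge0.
have kn_ge0 : 0 <= k * n by rewrite mulr_ge0.
have d1_gt0 : 0 < sigma2 * (1 + k) by rewrite mulr_gt0 //; lra.
have dn_gt0 : 0 < sigma2 * (1 + k * n) by rewrite mulr_gt0 //; lra.
have -> : alpha ^+ 2 * P * beta1 * beta2 * M%:R = P * beta1 * k.
  by rewrite /k; ring.
have -> : alpha ^+ 2 * P * beta1 * beta2 * n ^+ 2 * M%:R =
          P * beta1 * k * n * n.
  by rewrite /k; ring.
rewrite [leLHS]mulrAC ler_pdivrMr //.
rewrite [leRHS]mulrAC ler_pdivlMr // -[leRHS]mulrA.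
apply: ler_wpM2l; first by rewrite mulr_ge0 // mulr_ge0 // mulr_ge0.
(* What remains is 1 + k n <= n (1 + k), that is, 1 <= n. *)
by rewrite [leRHS]mulrCA ler_pM2l //; lra.
Qed.

Lemma SNR_NCR_gap (R : realType) (P sigma2 beta1 beta2 alpha : R) (M : nat) :
  0 < sigma2 -> 0 <= beta2 ->
  P * beta1 / sigma2 - SNR_NCR P sigma2 beta1 beta2 M alpha =
  P * beta1 / sigma2 / (1 + alpha ^+ 2 * beta2 * M%:R).
Proof.
move=> s_gt0 b2_ge0; rewrite /SNR_NCR.
have k_ge0 : 0 <= alpha ^+ 2 * beta2 * M%:R.
  by rewrite mulr_ge0 // mulr_ge0 ?sqr_ge0.
by field; apply/andP; split; apply: lt0r_neq0 => //; lra.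
Qed.

Theorem mainTheorem5 (R : realType) (M : nat)
    (P sigma2 beta1 beta2 alphaARIS : R)
    (M_ge1 : (1 <= M)%N) (P_gt0 : 0 < P) (sigma2_gt0 : 0 < sigma2)
    (beta1_gt0 : 0 < beta1) (beta2_gt0 : 0 < beta2)
    (alphaARIS_gt0 : 0 < alphaARIS) :
  [/\ SNR_PRIS P sigma2 beta1 beta2 M N @[N --> \oo] --> +oo,
      SNR_ARIS P sigma2 beta1 beta2 alphaARIS M N @[N --> \oo] --> +oo,
      (forall alphaNCR : R, 0 <= alphaNCR ->
         SNR_NCR P sigma2 beta1 beta2 M alphaNCR <= P * beta1 / sigma2) &
      SNR_NCR P sigma2 beta1 beta2 M alphaNCR @[alphaNCR --> +oo] -->
         P * beta1 / sigma2].
Proof.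
have M_gt0 : 0 < M%:R :> R by rewrite ltr0n.
have L_gt0 : 0 < P * beta1 / sigma2 by rewrite divr_gt0 ?mulr_gt0.
have k_ge0 x : 0 <= x ^+ 2 * beta2 * M%:R.
  by rewrite mulr_ge0 // mulr_ge0 ?sqr_ge0 // ltW.
have gap_ge0 x : 0 <= P * beta1 / sigma2 / (1 + x ^+ 2 * beta2 * M%:R).
  by rewrite divr_ge0 ?addr_ge0 // ltW.
split.
- apply: (@cvgry_ge_linear _ _ (P * beta1 * beta2 * M%:R / sigma2)).
    by rewrite divr_gt0 ?mulr_gt0.
  by move=> N; apply: SNR_PRIS_ge_linear; apply: ltW.
- apply: (@cvgry_ge_linear _ _ (alphaARIS ^+ 2 * P * beta1 * beta2 * M%:R /
    (sigma2 * (1 + alphaARIS ^+ 2 * beta2 * M%:R)))).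
    by rewrite divr_gt0 ?mulr_gt0 ?exprn_gt0 ?ltr_pwDl.
  by move=> N; apply: SNR_ARIS_ge_linear => //; apply: ltW.
- by move=> x _; rewrite -subr_ge0 SNR_NCR_gap // ltW.
- apply/cvgrPdist_le => e e_gt0; near=> x.
  rewrite SNR_NCR_gap ?(ltW beta2_gt0) // ger0_norm //.
  rewrite ler_pdivrMr ?ltr_pwDl // [leRHS]mulrC.
  (* The goal is now L <= e (1 + x^2 beta2 M). Since x >= 1 gives x <= x^2, a threshold linear in L
     / (e beta2 M) suffices and no square root is needed; the extra term e is simply dropped. *)
  have x_ge1 : 1 <= x by near: x; apply: nbhs_pinfty_ge.
  have : P * beta1 / sigma2 / (e * beta2 * M%:R) <= x.
    by near: x; apply: nbhs_pinfty_ge; rewrite num_real.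
  rewrite ler_pdivrMr ?mulr_gt0 // => /le_trans; apply.
  have -> : (1 + x ^+ 2 * beta2 * M%:R) * e =
    e + x * x * (e * beta2 * M%:R) by ring.
  rewrite -[leLHS]add0r lerD ?(ltW e_gt0) // ler_wpM2r //.
    by rewrite ltW ?mulr_gt0.
  by rewrite ler_peMr // (le_trans ler01).
Unshelve. all: by end_near.
Qed.
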